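(* Let $F\subseteq\{1,\dots,n\}$ and let $p\in\{1,\dots,n\}\setminus F$ be arbitrary. The minimal lifting number of a frugal splitting operator over $\mathcal{A}_n^F$ is equal to the minimal $p$-kernel rank over $\mathcal{A}_n^F$.
   Context: Throughout, $\mathcal{H}$ is a real Hilbert space with $\dim\mathcal{H}\ge 2$, and $n\in\mathbb{N}_+=\{1,2,\dots\}$. A set-valued operator $A\colon\mathcal{H}\to2^{\mathcal{H}}$ is called single-valued if $Ax$ is a singleton for every $x\in\mathcal{H}$, and is then identified with a map. $J_A=(\mathrm{Id}+A)^{-1}$ is the resolvent, $\operatorname{zer}A=\{x: 0\in Ax\}$, $\operatorname{fix}T=\{z:Tz=z\}$. Operator tuples: for $F\subseteq\{1,\dots,n\}$, $\mathcal{A}_n^F$ is the set of tuples $A=(A_1,\dots,A_n)$ where every $A_i\colon\mathcal{H}\to2^{\mathcal{H}}$ is maximally monotone and $A_i$ is single-valued for all $i\in F$. Parameterized operators: $T_{(\cdot)}\colon X\to Y$ parameterized by $\mathcal{A}_n^F$ means a map $T_A\colon X\to Y$ for each $A\in\mathcal{A}_n^F$. Matrices as operators: a matrix $B\in\mathbb{R}^{k\times m}$ acts on $z=(z_1,\dots,z_m)\in\mathcal{H}^m$ by $(Bz)_i=\sum_{j=1}^m B_{ij}z_j$. Frugal splitting operator: for $d\in\mathbb{N}_+$, $T_{(\cdot)}\colon\mathcal{H}^d\to\mathcal{H}^d$ parameterized by $\mathcal{A}_n^F$ is a frugal splitting operator over $\mathcal{A}_n^F$ if there exist $d_1,\dots,d_{n+1}\in\mathbb{N}_+$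 with $d_1=d_{n+1}=d$ and, for each $i\in\{1,\dots,n\}$, an operator $\tau_{i,(\cdot)}\colon\mathcal{H}^{d_i}\to\mathcal{H}^{d_{i+1}}$ parameterized by $\mathcal{A}_n^F$ such that, for all $A\in\mathcal{A}_n^F$: (1) $\operatorname{fix}T_A\neq\emptyset\iff\operatorname{zer}\sum_{i=1}^nA_i\ne\emptyset$; (2) $T_A=\tau_{n,A}\circ\tau_{n-1,A}\circ\cdots\circ\tau_{1,A}$; and moreover for each $i$ there exist $B_i\in\mathbb{R}^{d_{i+1}\times d_i}$, $C_i\in\mathbb{R}^{d_{i+1}\times1}$, $D_i\in\mathbb{R}^{1\times d_i}$, $\gamma_i>0$ (independent of $A$) such that for all $A\in\mathcal{A}_n^F$ and $z_i\in\mathcal{H}^{d_i}$, $\tau_{i,A}z_i=B_iz_i+C_iJ_{\gamma_iA_i}(D_iz_i)$ if $i\notin F$ and $\tau_{i,A}z_i=B_iz_i+C_iA_i(D_iz_i)$ if $i\in F$. Lifting: the lifting number of a frugal splitting operator $T_{(\cdot)}\colon\mathcal{H}^d\to\mathcal{H}^d$ over $\mathcal{A}_n^F$ is $d$. The minimal lifting over $\mathcal{A}_n^F$ is the smallest lifting number among all frugal splitting operators over $\mathcal{A}_n^F$. $p$-kernel: let $\Gamma_p=R_p-R_p^T\in\mathbb{R}^{n\times n}$, where $R_p$ has ones on the $p$th row and zeros elsewhere. A matrix $M\in\mathbb{R}^{n\times n}$ is a $p$-kernel over $\mathcal{A}_n^F$ if $p\notin F$, $M+\Gamma_p$ is lower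 triangular, $M_{i,i}\ge0$ for all $i\in\{1,\dots,n\}$, and $M_{i,i}=0$ if and only if $i\in F$. The minimal $p$-kernel rank over $\mathcal{A}_n^F$ is the smallest rank among all $p$-kernels over $\mathcal{A}_n^F$. *)

(* Defs.v *)
From HB Require Import structures.
From mathcomp Require Export all_boot all_order all_algebra.
From mathcomp Require Export boolp classical_sets reals topology normedtype.

Set Implicit Arguments.
Unset Strict Implicit.
Unset Printing Implicit Defensive.

Import Order.TTheory GRing.Theory Num.Theory.
Import numFieldNormedType.Exports.

Local Open Scope classical_set_scope.
Local Open Scope ring_scope.

(* A Hilbert space is a complete normed module whose norm is induced by a
   symmetric positive definite bilinear form ([{dot H for idfun}]). *)
Definition norm_from_inner (R : realType) (H : completeNormedModType R)
    (ip : {dot H for idfun}) : Prop :=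
  forall x : H, `|x| ^+ 2 = ip x x.

Definition dim_ge2 (R : realType) (H : lmodType R) : Prop :=
  exists x y : H,
    forall a b : R, a *: x + b *: y = 0 -> a = 0 /\ b = 0.

Section SetValuedOperators.
Context {R : realType} {H : completeNormedModType R}.
Implicit Types A B : H -> set H.

Definition single_valued A : Prop := forall x, exists u, A x = [set u].

Definition zer A : set H := [set x | A x 0].

Definition op_scale (g : R) A : H -> set H := fun x => [set g *: u | u in A x].

Definition op_sum n (A : 'I_n -> H -> set H) : H -> set H :=
  fun x => [set \sum_i u i | u in [set u : 'I_n -> H | forall i, A i x (u i)]].

Definition resolvent A : H -> set H :=
  fun x => [set y | [set y + u | u in A y] x].

Definition monotone (ip : {dot H for idfun}) A : Prop :=
  forall x y u v, A x u -> A y v -> 0 <= ip (x - y) (u - v).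

Definition maximally_monotone (ip : {dot H for idfun}) A : Prop :=
  monotone ip A /\
  forall B, monotone ip B -> (forall x, A x `<=` B x) -> B = A.

End SetValuedOperators.

Definition fix_set (X : Type) (T : X -> X) : set X := [set z | T z = z].

Record op_tuple (R : realType) (H : completeNormedModType R)
    (ip : {dot H for idfun}) n (F : {set 'I_n}) := OpTuple {
  ops :> 'I_n -> H -> set H;
  ops_maximally_monotone : forall i, maximally_monotone ip (ops i);
  ops_single_valued : forall i, i \in F -> single_valued (ops i) }.

Section FrugalSplitting.
Context {R : realType} {H : completeNormedModType R}.

Definition mxact k m (B : 'M[R]_(k, m)) (z : {ffun 'I_m -> H}) :
    {ffun 'I_k -> H} :=
  [ffun i => \sum_j B i j *: z j].

Definition ffcast m k (e : m = k) (z : {ffun 'I_m -> H}) : {ffun 'I_k -> H} :=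
  [ffun i => z (cast_ord (esym e) i)].

(* [compose_upto tau hk] is tau_(k-1) o ... o tau_0, indices starting at 0. *)
Fixpoint compose_upto n (dims : nat -> nat)
    (tau : forall i : 'I_n,
       {ffun 'I_(dims i) -> H} -> {ffun 'I_(dims i.+1) -> H})
    k : (k <= n)%N -> {ffun 'I_(dims 0%N) -> H} -> {ffun 'I_(dims k) -> H} :=
  match k with
  | 0%N => fun _ z => z
  | k'.+1 => fun (hk : (k' < n)%N) z =>
      tau (Ordinal hk) (compose_upto tau (ltnW hk) z)
  end.

(* The operators A_i (i in F) and J_(g A_i) (i notin F) are single-valued, so
   the identity tau z = B z + C S(D z) is an equality of singletons.  [H] and
   [H^1] are identified through the only index of ['I_1]. *)
Definition affine_step n (F : {set 'I_n}) (i : 'I_n) (Ai : H -> set H) m k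
    (B : 'M[R]_(k, m)) (C : 'cV[R]_k) (D : 'rV[R]_m) (g : R)
    (t : {ffun 'I_m -> H} -> {ffun 'I_k -> H}) : Prop :=
  let S := if i \in F then Ai else resolvent (op_scale g Ai) in
  forall z, [set t z] =
    [set mxact B z + mxact C [ffun=> y] | y in S (mxact D z ord0)].

(* Indices start at 0, so the spaces are H^(dims 0), ..., H^(dims n); the values
   of [dims] beyond n are irrelevant. *)
Definition frugal_splitting (ip : {dot H for idfun}) n (F : {set 'I_n}) d
    (T : op_tuple ip F -> {ffun 'I_d -> H} -> {ffun 'I_d -> H}) : Prop :=
  exists (dims : nat -> nat) (d_first : dims 0%N = d) (d_last : dims n = d)
    (tau : forall i : 'I_n, op_tuple ip F ->
       {ffun 'I_(dims i) -> H} -> {ffun 'I_(dims i.+1) -> H}),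
  [/\ forall k, (k <= n)%N -> (0 < dims k)%N,
      forall A : op_tuple ip F,
        fix_set (T A) !=set0 <-> zer (op_sum A) !=set0,
      forall (A : op_tuple ip F) z,
        T A z = ffcast d_last
          (compose_upto (fun i => tau i A) (leqnn n) (ffcast (esym d_first) z))
    & forall i : 'I_n,
        exists (B : 'M[R]_(dims i.+1, dims i)) (C : 'cV[R]_(dims i.+1))
               (D : 'rV[R]_(dims i)) (g : R),
          0 < g /\
          forall A : op_tuple ip F, affine_step F i (A i) B C D g (tau i A)].

Definition lifting_numbers (ip : {dot H for idfun}) n (F : {set 'I_n}) :
    set nat :=
  [set d | exists T : op_tuple ip F ->
             {ffun 'I_d -> H} -> {ffun 'I_d -> H}, frugal_splitting T].

End FrugalSplitting.

Definition ones_row (R : realType) n (p : 'I_n) : 'M[R]_n :=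
  \matrix_(i, j) (i == p)%:R.

Definition Gamma (R : realType) n (p : 'I_n) : 'M[R]_n :=
  ones_row R p - (ones_row R p)^T.

Definition p_kernel (R : realType) n (F : {set 'I_n}) (p : 'I_n)
    (M : 'M[R]_n) : Prop :=
  [/\ p \notin F,
      is_trig_mx (M + Gamma R p),
      forall i, 0 <= M i i
    & forall i, M i i = 0 <-> i \in F].

Definition kernel_ranks (R : realType) n (F : {set 'I_n}) (p : 'I_n) :
    set nat :=
  [set \rank M | M in [set M : 'M[R]_n | p_kernel F p M]].

Definition is_smallest (S : set nat) (m : nat) : Prop :=
  S m /\ forall k, S k -> (m <= k)%N.

(* Main.v *)
Require Import Defs.
From mathcomp Require Import ring lra zify.
From mathcomp Require Import interval_inference sequences.

Set Implicit Arguments.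
Unset Strict Implicit.
Unset Printing Implicit Defensive.

Import Order.TTheory GRing.Theory Num.Theory.
Import numFieldNormedType.Exports.
Local Open Scope classical_set_scope.
Local Open Scope ring_scope.

(** The theorem holds because, as far as its fixed points are concerned, a
    frugal splitting operator is a kernel.

    Run the [n] steps from a point [z] and record, for each [i], one point
    [(x_i, u_i)] of the graph of [A_i].  Split these points into [w] and [v]:
    [(w_p, v_p) = (x_p, u_p)], and [(w_i, v_i) = (u_i, x_i)] for the other
    indices.  A step uses its operator once, at an argument that is linear in
    [z] and in the earlier results, so the recorded points satisfy
    [v = U z - N w] with [N] lower triangular; the diagonal entry of [N] is [0]
    at a direct evaluation, and at a resolvent it is the positive step size or
    its inverse.  The end point is [P z + Q w].  Conversely, every choice of
    [P], [Q], [U] and such an [N] comes from a frugal splitting operator with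
    the same [d], which stores the components of [w] as they are computed.  This
    direction needs resolvents to be defined everywhere, that is, the theorem of
    Minty.  Hence [d] is a lifting number exactly when some [P], [Q], [U], [N]
    of this kind are such that, for all tuples, [z = P z + Q w] and
    [v = U z - N w] are solvable with points of the graphs iff the sum has a
    zero ([frugal_encodes], [encodes_frugal]).

    In the coordinates [w], [v], a zero of the sum is a solution of
    [v = - Gamma w] ([zerP]).

    From a kernel [M], write [M = U W] with [d] the rank of [M], and take
    [N = M + Gamma], [P = 0], [Q = W].  Then [z = W w] turns [U z - N w] into
    [- Gamma w], so that the encoding is correct ([kernel_encodes]).

    Conversely, consider a correct encoding.  Any solution of [z = P z + Q w] is
    a fixed point for every tuple whose graphs contain the points that it
    prescribes.  Constant operators and pairs of opposite skew operators through
    these points, which exist because the dimension is at least two, have a zero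
    of their sum only if [v = - Gamma w] ([encodes_Gamma]).  Next, translations
    of the identity make the solution [w] unique, and any prescribed [w] can be
    achieved; then [(N - Gamma) w = U z] for some [z] ([encodes_range]).
    So the range of the kernel [N - Gamma] lies in that of [U], and its rank is
    at most [d] ([encodes_rank]). *)

(** * Inner products *)

Section InnerProduct.
Context {R : realType} {H : completeNormedModType R} (ip : {dot H for idfun}).
Implicit Types (x y z : H) (a : R).

Lemma ipC x y : ip x y = ip y x.
Proof. by rewrite hermC expr0 mul1r. Qed.
Lemma ipDl x y z : ip (x + y) z = ip x z + ip y z. Proof. exact: linearDl. Qed.
Lemma ipNl x y : ip (- x) y = - ip x y. Proof. exact: linearNl. Qed.
Lemma ipZl a x y : ip (a *: x) y = a * ip x y. Proof. exact: linearZl_LR. Qed.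
Lemma ipDr x y z : ip x (y + z) = ip x y + ip x z.
Proof. by rewrite ipC ipDl !(ipC x). Qed.
Lemma ipNr x y : ip x (- y) = - ip x y. Proof. by rewrite ipC ipNl (ipC x). Qed.
Lemma ipZr a x y : ip x (a *: y) = a * ip x y.
Proof. by rewrite ipC ipZl (ipC x). Qed.
Lemma ip0l x : ip 0 x = 0. Proof. by rewrite -(scale0r 0) ipZl mul0r. Qed.
Lemma ip0r x : ip x 0 = 0. Proof. by rewrite ipC ip0l. Qed.
Lemma ip_eq0 x : ip x x = 0 -> x = 0.
Proof. by apply: contra_eq => /(neq0_dnorm_gt0 (s := ip)) /gt_eqF/negbT. Qed.
Lemma ip_ge0 x : 0 <= ip x x.
Proof.
have [->|/(neq0_dnorm_gt0 (s := ip))/ltW //] := eqVneq x 0.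
by rewrite ip0l.
Qed.

Lemma ip_suml I r (P : pred I) (f : I -> H) y :
  ip (\sum_(i <- r | P i) f i) y = \sum_(i <- r | P i) ip (f i) y.
Proof. exact: linear_sumlz. Qed.

Definition ipE := (ipDl, ipDr, ipNl, ipNr, ipZl, ipZr).
End InnerProduct.

(** * Minty's theorem *)

(** A monotone relation [A] that contains every point monotonically related to
    it satisfies [0 \in range (Id + A)].  Let [phi (x, u)] be the supremum of
    [<x, al> + <a, u> - <a, al>] over the graph of [A] (the Fitzpatrick
    function) and minimise [phi (x, u) + |x|^2 / 2 + |u|^2 / 2], which is
    strongly convex.  The first-order condition at the minimiser [(x0, u0)] says
    that [(- u0, - x0)] is related to [A], hence on its graph, and then that
    [x0 + u0 = 0]. *)
Section Minty.
Context {R : realType} {H : completeNormedModType R} (ip : {dot H for idfun}).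
Hypothesis hip : norm_from_inner ip.
Variable A : H -> set H.
Hypothesis monA : monotone ip A.
Hypothesis maxA :
  forall x u, (forall a al, A a al -> 0 <= ip (x - a) (u - al)) -> A x u.

Let pen (a al x u : H) : R :=
  ip x x / 2 + ip u u / 2 + ip x al + ip a u - ip a al.

(** The supremum is [+oo] off the domain of the Fitzpatrick function, so the
    epigraph is used in its place. *)
Let upper x u (c : R) := forall a al, A a al -> pen a al x u <= c.

(** [phi (x, u) >= <x, u>]: otherwise [(x, u)] is related to [A], hence on its
    graph, where equality holds. *)
Let upper_ge x u c : upper x u c -> ip (x + u) (x + u) / 2 <= c.
Proof.
move=> hb; case: (lerP (ip (x + u) (x + u) / 2) c) => // hc.
have Axu : A x u.
  apply: maxA => a al Aa; have := hb _ _ Aa; move: hc; rewrite /pen !ipE.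
  rewrite (ipC ip u x); lra.
have := hb _ _ Axu; move: hc; rewrite /pen !ipE (ipC ip u x); lra.
Qed.

Let upper_graph a al : A a al -> upper a al (ip (a + al) (a + al) / 2).
Proof.
move=> Aa b be Ab; have := monA Aa Ab; rewrite /pen !ipE (ipC ip al a); lra.
Qed.

Let levels : set R := [set c | exists x u, upper x u c].

Let nonemptyA : exists a al, A a al.
Proof.
apply: contrapT => h; apply: (h); exists 0, 0; apply: maxA => a al Aa.
by exfalso; apply: h; exists a, al.
Qed.

Let levels_ge0 : lbound levels 0.
Proof.
by move=> c [x [u /upper_ge]]; apply: le_trans; rewrite divr_ge0 ?ip_ge0.
Qed.

Let has_inf_levels : has_inf levels.
Proof.
split; last by exists 0; apply: levels_ge0.
have [a [al Aa]] := nonemptyA.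
by exists (ip (a + al) (a + al) / 2), a, al; apply: upper_graph.
Qed.

Let minlevel := inf levels.

Let minlevel_le c x u : upper x u c -> minlevel <= c.
Proof. by move=> h; apply: ge_inf; [case: has_inf_levels | exists x, u]. Qed.

(** Strong convexity, with modulus [1]. *)
Let segment (t c c' : R) x u x' u' :
  0 <= t <= 1 -> upper x u c -> upper x' u' c' ->
  upper (x + t *: (x' - x)) (u + t *: (u' - u))
      ((1 - t) * c + t * c' -
        t * (1 - t) * (ip (x' - x) (x' - x) + ip (u' - u) (u' - u)) / 2).
Proof.
move=> /andP[t0 t1] h h' a al Aa.
have t1' : 0 <= 1 - t by rewrite subr_ge0.
have hh := ler_wpM2l t1' (h _ _ Aa); have hh' := ler_wpM2l t0 (h' _ _ Aa).
apply: le_trans (_ : (1 - t) * pen a al x u + t * pen a al x' u'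
  - t * (1 - t) * (ip (x' - x) (x' - x) + ip (u' - u) (u' - u)) / 2 <= _).
  rewrite /pen !ipE (ipC ip x' x) (ipC ip u' u) le_eqVlt; apply/orP; left.
  by apply/eqP; field.
by rewrite lerD2r lerD.
Qed.

(** By strong convexity at midpoints, a minimising sequence is a Cauchy
    sequence. *)
Let min_exists : exists x u, upper x u minlevel.
Proof.
have ex k : exists xu : H * H, upper xu.1 xu.2 (minlevel + k.+1%:R^-1).
  have [|c [x [u hb]] hc] := @inf_adherent _ levels k.+1%:R^-1 _ has_inf_levels.
    by rewrite invr_gt0.
  by exists (x, u) => a al Aa; apply: le_trans (hb _ _ Aa) (ltW hc).
have [s hs] := choice ex.
have dist N j k : (N <= j)%N -> (N <= k)%N ->
  `|(s j).1 - (s k).1| ^+ 2 + `|(s j).2 - (s k).2| ^+ 2 <= 8 / N.+1%:R.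
  move=> Nj Nk.
  have le_upper i : (N <= i)%N -> upper (s i).1 (s i).2 (minlevel + N.+1%:R^-1).
    move=> Ni a al Aa; apply: le_trans (hs i _ _ Aa) _.
    by rewrite lerD2l lef_pV2 ?posrE // ler_nat.
  have half : 0 <= (2^-1 : R) <= 1 by apply/andP; split; lra.
  have /minlevel_le := segment half (le_upper _ Nk) (le_upper _ Nj).
  rewrite !hip; move: (_ + ip _ _) => D; move: (N.+1%:R^-1) => e; lra.
have small (e : R) : 0 < e -> exists N, 8 / N.+1%:R < e ^+ 2.
  move=> e0; have e20 : 0 < e ^+ 2 / 8 by rewrite divr_gt0 ?exprn_gt0.
  have [N _ hN] := near_infty_natSinv_lt (PosNum e20); exists N.
  by have := hN N (leqnn N); rewrite /= ltr_pdivlMr // mulrC.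
have dist_lt (v : nat -> H) (e : R) : 0 < e ->
    (forall j k, `|v j - v k| ^+ 2 <=
      `|(s j).1 - (s k).1| ^+ 2 + `|(s j).2 - (s k).2| ^+ 2) ->
    exists N, forall j k, (N <= j)%N -> (N <= k)%N -> `|v j - v k| < e.
  move=> e0 hv; have [N hN] := small e e0; exists N => j k Nj Nk.
  rewrite -(ltr_pXn2r (n := 2)) ?nnegrE ?(ltW e0) //.
  exact: le_lt_trans (hv j k) (le_lt_trans (dist _ _ _ Nj Nk) hN).
have cvgH (v : nat -> H) :
    (forall j k, `|v j - v k| ^+ 2 <=
      `|(s j).1 - (s k).1| ^+ 2 + `|(s j).2 - (s k).2| ^+ 2) ->
    cvg (v n @[n --> \oo]).
  move=> hv; apply/cauchy_cvgP/cauchyP => e e0.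
  have [N hN] := dist_lt v e e0 hv.
  exists (v N); exists N => // k /= Nk.
  by rewrite -ball_normE /= hN.
have /cvg_ex[x0 cx] : cvg ((s n).1 @[n --> \oo]).
  by apply: cvgH => j k; rewrite lerDl exprn_ge0.
have /cvg_ex[u0 cu] : cvg ((s n).2 @[n --> \oo]).
  by apply: cvgH => j k; rewrite lerDr exprn_ge0.
exists x0, u0 => a al Aa.
(* Completing the squares leaves only norms, whose continuity is at hand. *)
have penE x u : pen a al x u =
    `|x + al| * `|x + al| / 2 + `|u + a| * `|u + a| / 2
    + (- (ip al al / 2) - ip a a / 2 - ip a al).
  rewrite -!expr2 !hip /pen !ipE (ipC ip al x) (ipC ip a u); by field.
have cpen : pen a al (s n).1 (s n).2 @[n --> \oo] --> pen a al x0 u0.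
  rewrite penE; under eq_fun do rewrite penE.
  have cD (g : nat -> H) l b : g n @[n --> \oo] --> l ->
      `|g n + b| @[n --> \oo] --> `|l + b|.
    by move=> cg; apply: cvg_norm; apply: cvgD => //; exact: cvg_cst.
  apply: cvgD; last exact: cvg_cst.
  have half (g : nat -> R) (l : R) : g n @[n --> \oo] --> l ->
      g n * g n / 2 @[n --> \oo] --> l * l / 2.
    by move=> hg; apply: cvgM; [exact: (cvgM hg hg)|exact: cvg_cst].
  by apply: cvgD; apply: half; apply: cD.
have cb : minlevel + n.+1%:R^-1 @[n --> \oo] --> minlevel + 0.
  by apply: cvgD; [exact: cvg_cst | exact: cvg_harmonic].
rewrite -(addr0 minlevel); apply: ler_cvg_to cpen cb _.
by near=> n; apply: hs.
Unshelve. all: by end_near.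
Qed.

Lemma minty_zero : exists x u, A x u /\ x + u = 0.
Proof.
have [x0 [u0 h0]] := min_exists.
have key a al : A a al -> ip (x0 + u0) (x0 + u0) <= ip (a + u0) (al + x0).
  move=> Aa; have hge := upper_ge h0; have ha := upper_graph Aa.
  (* Compare the value at the minimiser with those on the segment towards
     [(a, al)], whose parameter then tends to [0]. *)
  set D := ip (a - x0) (a - x0) + ip (al - u0) (al - u0).
  have sm : minlevel + D / 2 <= ip (a + al) (a + al) / 2.
    have D0 : 0 <= D by rewrite addr_ge0 ?ip_ge0.
    have tstep t : 0 < t <= 1 ->
        (1 - t) * D / 2 <= ip (a + al) (a + al) / 2 - minlevel.
      move=> /andP[t0 t1].
      have t01 : 0 <= t <= 1 by rewrite (ltW t0).
      have /minlevel_le := segment t01 h0 ha; rewrite -/D => hm.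
      rewrite -(ler_pM2l t0); nra.
    rewrite -lerBrDl; apply/ler_addgt0Pr => e e0.
    have De : 0 < D + e by rewrite ltr_wpDl.
    (* With this parameter [t], the loss [t * D / 2] is below [e]. *)
    have t01 : 0 < e / (D + e) <= 1.
      by rewrite divr_gt0 //= ler_pdivrMr // mul1r lerDr.
    apply: le_trans (lerD (tstep _ t01) (lexx e)).
    have : e / (D + e) * D <= e.
      by rewrite mulrAC ler_pdivrMr // ler_wpM2l ?(ltW e0) // lerDl ltW.
    lra.
  move: hge sm; rewrite /D !ipE.
  rewrite (ipC ip x0 a) (ipC ip u0 al) (ipC ip u0 x0) (ipC ip al a); lra.
have A0 : A (- u0) (- x0).
  apply: maxA => a al /key h.
  rewrite -opprD -opprD ipNl ipNr opprK (addrC u0) (addrC x0).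
  exact: le_trans (ip_ge0 _ _) h.
exists (- u0), (- x0); split => //.
have := key _ _ A0; rewrite addNr ip0l => h.
have : ip (x0 + u0) (x0 + u0) = 0 by apply/eqP; rewrite eq_le h ip_ge0.
by move/ip_eq0 => h'; rewrite -opprD addrC h' oppr0.
Qed.
End Minty.

(** * Maximally monotone operators *)

Section Ops.
Context {R : realType} {H : completeNormedModType R} (ip : {dot H for idfun}).
Implicit Types A : H -> set H.

(** Adjoining a related point to the graph keeps it monotone. *)
Lemma maximally_monotone_mem A x u : maximally_monotone ip A ->
  (forall a al, A a al -> 0 <= ip (x - a) (u - al)) -> A x u.
Proof.
move=> [monA maxA] h; pose B y := A y `|` [set v | y = x /\ v = u].
suff <- : B = A by right.
apply: maxA => [y y' v v' [Av|[-> ->]] [Av'|[-> ->]]|y v]; last by left.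
- exact: monA.
- by rewrite -opprB -(opprB u) ipNl ipNr opprK; apply: h.
- exact: h.
- by rewrite subrr ip0l.
Qed.

Lemma resolvent_scaleE A g y x :
  resolvent (op_scale g A) y x <-> exists2 u, A x u & y = x + g *: u.
Proof.
split=> [[_ [u Au <-] <-]|[u Au ->]]; first by exists u.
by exists (g *: u) => //; exists u.
Qed.

(** Existence is [minty_zero] for [x |-> g *: A x - y]. *)
Theorem resolvent_singleton A g y : norm_from_inner ip ->
  maximally_monotone ip A -> 0 < g ->
  exists x, resolvent (op_scale g A) y = [set x].
Proof.
move=> hip mA g0; have gN0 : g != 0 by rewrite gt_eqF.
pose A' x : set H := [set v | A x (g^-1 *: (v + y))].
have monA' : monotone ip A'.
  move=> x x' v v' /= Av Av'; have := mA.1 _ _ _ _ Av Av'.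
  by rewrite -scalerBr opprD addrACA subrr addr0 ipZr pmulr_rge0 ?invr_gt0.
have maxA' x v : (forall a al, A' a al -> 0 <= ip (x - a) (v - al)) -> A' x v.
  move=> h; apply: maximally_monotone_mem mA _ => a al Aa.
  have := h a (g *: al - y); rewrite /A' /= subrK scalerK // => /(_ Aa).
  rewrite opprB addrA -{1}(scalerKV gN0 (v + y)) -scalerBr ipZr.
  by rewrite pmulr_rge0.
have [x [v [Av xv]]] := minty_zero hip monA' maxA'.
exists x; apply/seteqP; split => [x' /resolvent_scaleE[u Au def_y]|_ ->].
  have := mA.1 _ _ _ _ Au Av.
  have -> : u - g^-1 *: (v + y) = - (g^-1 *: (x' - x)).
    have -> : v + y = (x' - x) + g *: u.
      by rewrite -(addr0_eq xv) {1}def_y addrA (addrC (- x)).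
    by rewrite scalerDr scalerK // opprD addrCA subrr addr0.
  rewrite ipNr ipZr oppr_ge0 pmulr_rle0 ?invr_gt0 // => le0.
  have : ip (x' - x) (x' - x) = 0 by apply/eqP; rewrite eq_le le0 ip_ge0.
  by move/ip_eq0/subr0_eq.
apply/resolvent_scaleE; exists (g^-1 *: (v + y)) => //.
by rewrite scalerKV // addrA xv add0r.
Qed.

Lemma linear_subE (K : H -> H) :
  linear K -> forall x y, K (x - y) = K x - K y.
Proof. by move=> linK x y; rewrite addrC -scaleN1r linK scaleN1r addrC. Qed.

(** Testing a related point [(x, v)] against the graph at [x + t *: h], with
    [h := v - (c + K x)], gives [|h|^2 <= t * <h, K h>] for all [t > 0]. *)
Lemma affine_maximally_monotone (K : H -> H) c : linear K ->
  (forall h, 0 <= ip h (K h)) -> maximally_monotone ip (fun y => [set c + K y]).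
Proof.
move=> linK K_ge0.
have KB := linear_subE linK.
split=> [x y _ _ -> ->|B monB sub].
  by rewrite opprD addrACA subrr add0r -KB.
apply: funext => x; apply/seteqP; split=> v; last exact: sub.
move=> Bv /=; apply: subr0_eq; set h := v - _.
have step t : 0 < t -> ip h h <= t * ip h (K h).
  move=> t0; have /(monB _ _ _ _ Bv) : B (x + t *: h) (c + K (x + t *: h)).
    exact: sub.
  have -> : v - (c + K (x + t *: h)) = h - t *: K h.
    by rewrite (addrC x) linK addrCA addrC opprD addrA -/h.
  rewrite opprD addrA subrr add0r ipNl ipZl !ipE -mulrN pmulr_rge0 //; lra.
apply: (@ip_eq0 _ _ ip); apply/eqP; rewrite eq_le ip_ge0 andbT leNgt.
apply/negP => hh_gt0; have q_gt0 : 0 < ip h (K h).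
  by apply: lt_le_trans hh_gt0 _; rewrite -[leRHS]mul1r step.
have := step (ip h h / ip h (K h) / 2); rewrite !divr_gt0 // => /(_ isT).
by rewrite mulrAC divfK ?gt_eqF //; lra.
Qed.
End Ops.

(** * Matrices acting on powers of the space *)

Section MatrixAction.
Context {R : realType} {H : completeNormedModType R}.

Lemma ffun_addE (I : finType) (f g : {ffun I -> H}) i : (f + g) i = f i + g i.
Proof. by rewrite ffunE. Qed.

Lemma ffun_subE (I : finType) (f g : {ffun I -> H}) i : (f - g) i = f i - g i.
Proof. by rewrite !ffunE. Qed.

Lemma mxactE k m (B : 'M[R]_(k, m)) (z : {ffun 'I_m -> H}) i :
  mxact B z i = \sum_j B i j *: z j.
Proof. by rewrite ffunE. Qed.

Lemma mxactM k m l (B : 'M[R]_(k, m)) (C : 'M_(m, l)) (z : {ffun 'I_l -> H}) :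
  mxact (B *m C) z = mxact B (mxact C z).
Proof.
apply/ffunP => i; rewrite !mxactE.
under [RHS]eq_bigr do rewrite mxactE scaler_sumr.
rewrite exchange_big /=; apply: eq_bigr => j _.
by rewrite mxE scaler_suml; apply: eq_bigr => a _; rewrite scalerA.
Qed.

Lemma mxactDl k m (B C : 'M[R]_(k, m)) (z : {ffun 'I_m -> H}) :
  mxact (B + C) z = mxact B z + mxact C z.
Proof.
apply/ffunP => i; rewrite mxactE ffunE !mxactE -big_split /=.
by apply: eq_bigr => j _; rewrite mxE scalerDl.
Qed.

Lemma mxactNl k m (B : 'M[R]_(k, m)) (z : {ffun 'I_m -> H}) :
  mxact (- B) z = - mxact B z.
Proof.
apply/ffunP => i; rewrite mxactE ffunE !mxactE -sumrN /=.
by apply: eq_bigr => j _; rewrite mxE scaleNr.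
Qed.

Lemma mxactDr k m (B : 'M[R]_(k, m)) (y z : {ffun 'I_m -> H}) :
  mxact B (y + z) = mxact B y + mxact B z.
Proof.
apply/ffunP => i; rewrite mxactE ffunE !mxactE -big_split /=.
by apply: eq_bigr => j _; rewrite ffunE scalerDr.
Qed.

Lemma mxact0 k m (z : {ffun 'I_m -> H}) : mxact (0 : 'M[R]_(k, m)) z = 0.
Proof.
by apply/ffunP => i; rewrite mxactE ffunE big1 // => j _; rewrite mxE scale0r.
Qed.

Lemma mxact1 m (z : {ffun 'I_m -> H}) : mxact (1%:M : 'M[R]_m) z = z.
Proof.
apply/ffunP => i; rewrite mxactE (bigD1 i) //= mxE eqxx scale1r big1 ?addr0 //.
by move=> j /negbTE ji; rewrite mxE eq_sym ji scale0r.
Qed.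

Lemma mxactZl k m a (B : 'M[R]_(k, m)) (z : {ffun 'I_m -> H}) i :
  mxact (a *: B) z i = a *: mxact B z i.
Proof.
rewrite !mxactE scaler_sumr; apply: eq_bigr => j _.
by rewrite mxE scalerA.
Qed.

Lemma mxact_outer k m (c : R) (C : 'cV_k) (D : 'rV_m) (z : {ffun 'I_m -> H}) i :
  mxact (c *: (C *m D)) z i = (c * C i ord0) *: mxact D z ord0.
Proof.
rewrite !mxactE scaler_sumr; apply: eq_bigr => j _.
by rewrite !mxE big_ord1 scalerA mulrA.
Qed.

Lemma ffcast_id m (e : m = m) (z : {ffun 'I_m -> H}) : ffcast e z = z.
Proof. by apply/ffunP => i; rewrite ffunE cast_ord_id. Qed.

Lemma ffcast_mxact m k l (e : m = k) (M : 'M[R]_(m, l)) (z : {ffun 'I_l -> H}) :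
  ffcast e (mxact M z) = mxact (castmx (e, erefl) M) z.
Proof.
apply/ffunP => i; rewrite ffunE !mxactE; apply: eq_bigr => j _.
by rewrite castmxE /= cast_ord_id.
Qed.

Lemma mxact_Gamma n (p : 'I_n) (w : {ffun 'I_n -> H}) i :
  mxact (- Gamma R p) w i = w p - (i == p)%:R *: \sum_j w j.
Proof.
have -> : w p = \sum_j (1%:M : 'M[R]_n) p j *: w j by rewrite -mxactE mxact1.
rewrite mxactE scaler_sumr -sumrB.
by apply: eq_bigr => j _; rewrite !mxE opprB scalerBl (eq_sym p).
Qed.
End MatrixAction.

(** * Encodings of the zeros of the sum *)

Section Encoding.
Context {R : realType} {H : completeNormedModType R} (ip : {dot H for idfun}).
Context {n : nat} (F : {set 'I_n}) (p : 'I_n).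

(** The point of the graph of [A i] is [(w i, v i)] for [i = p] and [(v i, w i)]
    for the other indices; this makes [w] the variable of the primal-dual
    inclusion in which [x_p] is the primal component. *)
Definition pd_rel (A : op_tuple ip F) (w v : {ffun 'I_n -> H}) : Prop :=
  forall i, if i == p then A i (w i) (v i) else A i (v i) (w i).

(** At a zero [x] with values [u_i], [w] consists of [x] and the [u_i] for
    [i != p], so [- Gamma w] is [x] off [p] and, the values having sum [0], [u_p]
    at [p]. *)
Lemma zerP (A : op_tuple ip F) :
  zer (op_sum A) !=set0 <-> exists w, pd_rel A w (mxact (- Gamma R p) w).
Proof.
split=> [[x [u Au sum_u]]|[w rel_w]].
  exists [ffun i => if i == p then x else u i] => i.
  rewrite mxact_Gamma !ffunE eqxx; case: eqVneq => [->|_]; last first.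
    by rewrite scale0r subr0.
  suff -> : x - 1 *: \sum_j [ffun i0 => if i0 == p then x else u i0] j = u p.
    exact: Au.
  rewrite scale1r (bigD1 p) //= ffunE eqxx opprD addrA subrr add0r.
  apply/eqP; rewrite eqr_oppLR -addr_eq0; apply/eqP; rewrite -[RHS]sum_u.
  rewrite [RHS](bigD1 p) //= addrC; congr (_ + _); apply: eq_bigr => j /negbTE jp.
  by rewrite ffunE jp.
pose v := mxact (- Gamma R p) w.
exists (w p), (fun i => if i == p then v i else w i).
  move=> i; have := rel_w i; case: eqVneq => // [->//|ip'].
  by rewrite mxact_Gamma (negbTE ip') scale0r subr0.
rewrite (bigD1 p) //= eqxx /v mxact_Gamma eqxx scale1r [X in _ - X](bigD1 p) //=.
rewrite opprD addrA subrr add0r addrC (eq_bigr w) ?subrr // => i /negbTE -> //.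
Qed.

(** The condition relating the fixed points of a frugal splitting operator to the
    zeros of the sum, in terms of the matrices that describe its runs. *)
Definition encodes d (P : 'M[R]_d) (Q : 'M_(d, n)) (U : 'M_(n, d))
    (N : 'M_n) : Prop :=
  forall A : op_tuple ip F,
    (exists z w, z = mxact P z + mxact Q w /\
       pd_rel A w (mxact U z - mxact N w)) <->
    zer (op_sum A) !=set0.

Definition affine_tuple (K : 'I_n -> H -> H) (c : 'I_n -> H)
    (linK : forall i, linear (K i)) (K_ge0 : forall i h, 0 <= ip h (K i h)) :
    op_tuple ip F :=
  OpTuple (ops := fun i y => [set c i + K i y])
    (fun i => affine_maximally_monotone (c i) (linK i) (K_ge0 i))
    (fun i _ y => ex_intro _ (c i + K i y) erefl).

Definition skew (x y h : H) : H := ip h x *: y - ip h y *: x.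

Lemma skew_linear x y : linear (skew x y).
Proof.
by move=> a h h'; rewrite /skew !ipE !scalerDl opprD addrACA scalerBr !scalerA.
Qed.

Lemma skew_ip x y h : ip h (skew x y h) = 0.
Proof. by rewrite /skew !ipE mulrC subrr. Qed.

(** If all [skew h y h] vanished, every [y] would be a multiple of [h]. *)
Lemma skew_neq0 h : dim_ge2 H -> h != 0 -> exists y, skew h y h != 0.
Proof.
move=> [x [y free_xy]] h0; have hh0 : ip h h != 0.
  by rewrite gt_eqF // (neq0_dnorm_gt0 (s := ip)).
apply: contrapT => /forallNP no.
have prop z : ip h h *: z = ip h z *: h.
  by apply: subr0_eq; apply/eqP; apply: contrapT => /negP; apply: no.
have [|/eqP+ _] := free_xy (ip h y * ip h h) (- (ip h x * ip h h)).
  by rewrite scaleNr -!scalerA !prop !scalerA mulrC subrr.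
rewrite mulf_eq0 (negbTE hh0) orbF => /eqP hy.
have y0 : y = 0.
  by apply/eqP; have /eqP := prop y; rewrite hy scale0r scaler_eq0 (negbTE hh0).
have [|_ /eqP] := free_xy 0 1; last by rewrite oner_eq0.
by rewrite y0 scaler0 scale0r addr0.
Qed.

Section EncodingConsequences.
Hypothesis dim2 : dim_ge2 H.
Variables (d : nat) (P : 'M[R]_d) (Q : 'M[R]_(d, n)).
Variables (U : 'M[R]_(n, d)) (N : 'M[R]_n).
Hypothesis enc : encodes P Q U N.

(** The graphs of the affine operators [y |-> u_i + K_i (y - x_i)] contain the
    points prescribed by the solution, so the sum of these operators must have
    a zero.  With [K = 0] this says that the [u_i] have sum [0]; with opposite
    skew operators at two indices, whose sum is constant, it says that the
    corresponding [x_i] agree. *)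
Lemma encodes_Gamma (z : {ffun 'I_d -> H}) (w : {ffun 'I_n -> H}) :
  z = mxact P z + mxact Q w ->
  mxact U z - mxact N w = mxact (- Gamma R p) w.
Proof.
move=> fix_z; set v := _ - _.
pose x i := if i == p then w i else v i.
pose u i := if i == p then v i else w i.
have zero K : (forall i, linear (K i)) -> (forall i h, 0 <= ip h (K i h)) ->
    exists y, \sum_i u i + \sum_i K i (y - x i) = 0.
  move=> linK K_ge0.
  have KB i := linear_subE (linK i).
  pose A := affine_tuple (fun i => u i - K i (x i)) linK K_ge0.
  have [|y [t At sum_t]] := (enc A).1.
    exists z, w; split => // i; rewrite -/v.
    by have := subrK (K i (x i)) (u i); rewrite /= /x /u; case: eqP => _ /esym.
  exists y; rewrite -[RHS]sum_t -big_split /=; apply: eq_bigr => i _.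
  by rewrite (At i) /= KB addrA addrAC.
have sum_u : \sum_i u i = 0.
  have [||y] := zero (fun _ _ => 0).
  - by move=> i a b b'; rewrite scaler0 addr0.
  - by move=> i h; rewrite ip0r.
  by rewrite big1_eq addr0.
have x_const i : x i = w p.
  rewrite -[w p]/(if true then w p else v p) -(eqxx p) -/(x p).
  have [->//|i_p] := eqVneq i p.
  apply/eqP; rewrite -subr_eq0; apply: contrapT => /negP neq0.
  have [y] := skew_neq0 dim2 neq0; set J := skew _ _ => /negP; apply.
  have linJ : linear J by apply: skew_linear.
  have JB := linear_subE linJ.
  pose s j : R := (j == p)%:R - (j == i)%:R.
  have [||t] := zero (fun j h => s j *: J h).
  - move=> j a b b'; rewrite linJ scalerDr !scalerA mulrC //.
  - by move=> j h; rewrite ipZr skew_ip mulr0.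
  rewrite sum_u add0r (bigD1 p) //= (bigD1 i) //= big1; last first.
    by move=> j /andP[/negbTE jp /negbTE ji]; rewrite /= /s jp ji subrr scale0r.
  rewrite /s !eqxx (negbTE i_p) (eq_sym p) (negbTE i_p) subr0 sub0r.
  rewrite scale1r scaleN1r addr0 -JB.
  by rewrite opprB addrC addrA subrK => ->.
apply/ffunP => i; rewrite mxact_Gamma; have := x_const i; rewrite /x.
case: eqVneq => [-> _|_ ->]; last by rewrite scale0r subr0.
rewrite scale1r; move: sum_u; rewrite (bigD1 p) //= {1}/u eqxx => /eqP.
rewrite addr_eq0 => /eqP ->; rewrite [X in _ - X](bigD1 p) //=.
rewrite opprD addrA subrr add0r.
by congr (- _); apply: eq_bigr => j /negbTE; rewrite /u => ->.
Qed.

(** Prescribe [w0 = omega *: e] with a nonzero vector [e].  The operators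
    [y |-> u_i + (y - x)] have a zero [x] with the values [u_i], so that the
    encoding provides some [z] and [w]; strong monotonicity forces [w = w0], and
    the inner product with [e] returns to real coefficients. *)
Lemma encodes_range (omega : 'cV[R]_n) :
  exists zeta : 'cV[R]_d, (N - Gamma R p) *m omega = U *m zeta.
Proof.
have [e e0] : exists e : H, e != 0.
  have [x [y h]] := dim2; exists x; apply/eqP => x0.
  have [] := h 1 0; first by rewrite x0 scaler0 scale0r addr0.
  by move/eqP; rewrite oner_eq0.
have ee0 : ip e e != 0 by rewrite gt_eqF // (neq0_dnorm_gt0 (s := ip)).
pose w0 : {ffun 'I_n -> H} := [ffun i => omega i ord0 *: e].
pose v0 := mxact (- Gamma R p) w0.
pose x0 := w0 p.
pose u0 i := if i == p then v0 i else w0 i.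
have lin_id : forall _ : 'I_n, linear (fun h : H => h) by [].
have id_ge0 (_ : 'I_n) (h : H) : 0 <= ip h h by exact: ip_ge0.
pose A := affine_tuple (fun i => u0 i - x0) lin_id id_ge0.
have [_ /(_ _)[]] := enc A.
  apply/zerP; exists w0 => i; rewrite -/v0 /= /u0; case: eqVneq => [->|i_p].
    by rewrite /x0 subrK.
  by rewrite /v0 mxact_Gamma (negbTE i_p) scale0r subr0 subrK.
move=> z [w [fix_z rel]]; have := encodes_Gamma fix_z => def_v.
rewrite def_v in rel.
(* The common shift [delta] of the components of [w] has [n *: delta = 0]. *)
pose delta := w p - x0.
have w_shift i : w i = w0 i + delta.
  have [->|i_p] := eqVneq i p; first by rewrite addrC subrK.
  have := rel i.
  rewrite (negbTE i_p) mxact_Gamma (negbTE i_p) scale0r subr0 => ->.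
  by rewrite /u0 (negbTE i_p) addrAC addrA.
have delta0 : delta = 0.
  have := rel p; rewrite eqxx /= mxact_Gamma eqxx scale1r /u0 eqxx.
  rewrite /v0 mxact_Gamma eqxx scale1r -/x0 (eq_bigr _ (fun i _ => w_shift i)).
  rewrite big_split /= sumr_const card_ord => h; apply/eqP.
  have : n%:R *: delta == 0.
    rewrite scaler_nat; apply/eqP.
    have {}h : w p - (\sum_i w0 i + delta *+ n) = w p - \sum_i w0 i.
      by rewrite h (addrAC x0) subrr add0r addrC.
    by move/addrI/oppr_inj: h => /eqP; rewrite -subr_eq0 addrC addKr => /eqP.
  by rewrite scaler_eq0 pnatr_eq0 -leqn0 leqNgt (leq_ltn_trans _ (ltn_ord p)).
have def_w : w = w0 by apply/ffunP => i; rewrite w_shift delta0 addr0.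
exists (\col_i (ip (z i) e / ip e e)); apply/colP => i.
have := congr1 (fun f : {ffun 'I_n -> H} => ip (f i) e / ip e e) def_v.
rewrite def_w /= !ffunE !ipE !ip_suml => def_vi.
have scal (B : 'M[R]_n) : (\sum_j ip (B i j *: w0 j) e) / ip e e =
    \sum_j B i j * omega j ord0.
  rewrite mulr_suml; apply: eq_bigr => j _.
  by rewrite ffunE !ipZl !mulrA mulfK.
have scalU : (\sum_j ip (U i j *: z j) e) / ip e e =
    \sum_j U i j * (\col_i (ip (z i) e / ip e e)) j ord0.
  by rewrite mulr_suml; apply: eq_bigr => j _; rewrite mxE ipZl mulrA.
have mulE (B : 'M[R]_n) : (B *m omega) i ord0 = \sum_j B i j * omega j ord0.
  by rewrite mxE.
rewrite mulmxBl -mulNmx mxE !mulE [RHS]mxE.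
move: def_vi; rewrite mulrBl scalU !scal => <-.
by rewrite addrC subrK.
Qed.
End EncodingConsequences.
End Encoding.

(** * Encodings and kernels *)

Section KernelEncoding.
Context {R : realType} {H : completeNormedModType R} (ip : {dot H for idfun}).
Context {n : nat} (F : {set 'I_n}) (p : 'I_n).

Lemma encodes_rank d (P : 'M[R]_d) Q (U : 'M_(n, d)) (N : 'M_n) : dim_ge2 H ->
  encodes ip F p P Q U N -> (\rank (N - Gamma R p)%R <= d)%N.
Proof.
move=> dim2 enc.
have [Z hZ] := choice (fun j : 'I_n => encodes_range dim2 enc (delta_mx j ord0)).
have -> : N - Gamma R p = U *m (\matrix_(i, j) Z j i ord0).
  apply/matrixP => i j; rewrite [RHS]mxE.
  have := congr1 (fun X : 'cV_n => X i ord0) (hZ j).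
  rewrite -colE [LHS]mxE => ->; rewrite mxE.
  by apply: eq_bigr => k _; rewrite mxE.
exact: leq_trans (mxrankM_maxl _ _) (rank_leq_col _).
Qed.

(** Here [P = 0] and [Q = row_base M], so [z] is determined by [w] and
    [U z = col_base M *m row_base M w = M w]. *)
Lemma kernel_encodes (M : 'M[R]_n) :
  encodes ip F p 0 (row_base M) (col_base M) (M + Gamma R p).
Proof.
have rangeE (w : {ffun 'I_n -> H}) :
    mxact (col_base M) (mxact (row_base M) w) - mxact (M + Gamma R p) w =
    mxact (- Gamma R p) w.
  by rewrite -mxactM mulmx_base mxactDl opprD addrA subrr add0r mxactNl.
move=> A; split=> [[z [w []]]|/(zerP p)[w rel_w]].
  rewrite mxact0 add0r => ->; rewrite rangeE => rel_w.
  by apply/(zerP p); exists w.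
by exists (mxact (row_base M) w), w; rewrite rangeE mxact0 add0r.
Qed.
End KernelEncoding.

(** * One step in primal-dual coordinates *)

(** A step evaluates [s] in [A_i y] or in the resolvent at [y].  The point of the
    graph that it finds is recorded as [w_i] and [v_i]; in all cases [s] and [v_i]
    are linear in [y] and [w_i]:
    - [i \in F]: [s = w] and [v = y];
    - [i = p]: [s = w] and [v = (y - w) / gam];
    - otherwise: [s = y - gam *: w] and [v = y - gam *: w].
    The coefficients below express this uniformly, as
    [s = in_coef *: y + dual_coef *: w] and
    [v = row_coef *: y - diag_coef *: w]. *)
Section Steps.
Context {R : realType} {H : completeNormedModType R} (ip : {dot H for idfun}).
Context {n : nat} (F : {set 'I_n}) (p : 'I_n).
Hypothesis pF : p \notin F.
Variable gam : 'I_n -> R.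
Hypothesis gam_gt0 : forall i, 0 < gam i.

Definition eval (A : op_tuple ip F) i : H -> set H :=
  if i \in F then A i else resolvent (op_scale (gam i) (A i)).

Definition in_coef i : R := if (i \in F) || (i == p) then 0 else 1.
Definition dual_coef i : R := if (i \in F) || (i == p) then 1 else - gam i.
Definition row_coef i : R := if i == p then (gam i)^-1 else 1.
Definition diag_coef i : R :=
  if i \in F then 0 else if i == p then (gam i)^-1 else gam i.

Definition step_rel (A : op_tuple ip F) i (y w : H) : Prop :=
  let v := row_coef i *: y - diag_coef i *: w in
  if i == p then A i w v else A i v w.

Lemma eval_step_rel A i y w :
  eval A i y (in_coef i *: y + dual_coef i *: w) <-> step_rel A i y w.
Proof.
have gN0 : gam i != 0 by rewrite gt_eqF.
rewrite /eval /step_rel /in_coef /dual_coef /row_coef /diag_coef.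
have [->|i_p] := eqVneq i p.
  rewrite (negbTE pF) /= scale0r scale1r add0r.
  split=> [/resolvent_scaleE[u Au ->]|Av].
    by rewrite scalerDr addrAC subrr add0r scalerK ?gt_eqF.
  apply/resolvent_scaleE; exists ((gam p)^-1 *: y - (gam p)^-1 *: w) => //.
  by rewrite -scalerBr scalerKV ?gt_eqF // addrC subrK.
case: ifP => iF; first by rewrite /= !scale0r !scale1r add0r subr0.
rewrite /= !scale1r scaleNr; split=> [/resolvent_scaleE[u Au]|Aw].
  move/eqP; rewrite -addrA -subr_eq0 opprD addrA subrr add0r opprD opprK subr_eq0.
  by move=> /eqP/(scalerI gN0) def_u; rewrite -def_u in Au.
by apply/resolvent_scaleE; exists w => //; rewrite subrK.
Qed.

Lemma dual_coef_neq0 i : dual_coef i != 0.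
Proof.
rewrite /dual_coef; case: ifP => _; first exact: oner_neq0.
by rewrite oppr_eq0 gt_eqF.
Qed.

Lemma eval_ex_step_rel A i y s : eval A i y s ->
  exists2 w, step_rel A i y w & s = in_coef i *: y + dual_coef i *: w.
Proof.
pose w := (dual_coef i)^-1 *: (s - in_coef i *: y).
have def_s : s = in_coef i *: y + dual_coef i *: w.
  by rewrite scalerKV ?dual_coef_neq0 // addrC subrK.
by move=> As; exists w => //; apply/eval_step_rel; rewrite -def_s.
Qed.
End Steps.

(** * Runs of a sequence of steps *)

Section Trajectories.
Context {R : realType} {H : completeNormedModType R} (ip : {dot H for idfun}).
Context {n : nat} (F : {set 'I_n}) (p : 'I_n).
Hypothesis pF : p \notin F.
Variables (dims : nat -> nat)
  (tau : forall i : 'I_n, op_tuple ip F ->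
     {ffun 'I_(dims i) -> H} -> {ffun 'I_(dims i.+1) -> H})
  (B : forall i : 'I_n, 'M[R]_(dims i.+1, dims i))
  (C : forall i : 'I_n, 'cV[R]_(dims i.+1))
  (D : forall i : 'I_n, 'rV[R]_(dims i))
  (gam : 'I_n -> R).
Hypothesis gam_gt0 : forall i, 0 < gam i.
Hypothesis tau_step : forall i (A : op_tuple ip F),
  affine_step F i (A i) (B i) (C i) (D i) (gam i) (@tau i A).

Definition traj A k (hk : (k <= n)%N) (z : {ffun 'I_(dims 0%N) -> H}) :=
  compose_upto (fun i => @tau i A) hk z.

Definition input A z i : H :=
  mxact (D i) (traj A (ltnW (ltn_ord i)) z) ord0.

Lemma inputE A z k (hk : (k < n)%N) :
  input A z (Ordinal hk) =
  mxact (D (Ordinal hk)) (traj A (k := k) (ltnW hk) z) ord0.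
Proof.
by rewrite /input (bool_irrelevance (ltnW (ltn_ord (Ordinal hk))) (ltnW hk)).
Qed.

Lemma traj_ex A z : exists w : {ffun 'I_n -> H},
  forall i, step_rel p gam A i (input A z i) (w i).
Proof.
have ex i : exists w, step_rel p gam A i (input A z i) w.
  have /seteqP[/(_ _ erefl)[s hs _] _] :=
    @tau_step i A (traj A (ltnW (ltn_ord i)) z).
  by have [w rel _] := eval_ex_step_rel (p := p) pF gam_gt0 (s := s) hs; exists w.
by have [w hw] := choice ex; exists [ffun i => w i] => i; rewrite ffunE.
Qed.

(** Substitute [s = in_coef *: y + dual_coef *: w] into the value of the step. *)
Lemma traj_step A z (w : {ffun 'I_n -> H}) k (hk : (k < n)%N) (i := Ordinal hk) :
  step_rel p gam A i (input A z i) (w i) ->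
  traj A hk z =
    mxact (B i + in_coef F p i *: (C i *m D i)) (traj A (k := k) (ltnW hk) z)
    + mxact (dual_coef F p gam i *: (C i *m delta_mx ord0 i)) w.
Proof.
move=> /(eval_step_rel pF gam_gt0) hs.
have /seteqP[_ sub] := @tau_step i A (traj A (ltnW hk) z).
have -> : traj A hk z = @tau i A (traj A (ltnW hk) z) by [].
rewrite inputE -/i in hs; have /= <- := sub _ (ex_intro2 _ _ _ hs erefl).
apply/ffunP => a; rewrite mxactDl !ffun_addE !mxact_outer -addrA.
congr (_ + _); rewrite (mxactE (C i)) big_ord1 ffunE scalerDr !scalerA.
rewrite ![_ * C i _ _]mulrC.
congr (_ + _ *: _); rewrite mxactE (bigD1 i) //= mxE !eqxx scale1r big1 ?addr0 //.
by move=> j /negbTE ji; rewrite mxE ji scale0r.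
Qed.

(** The matrices do not depend on the tuple [A]: the operators enter only through
    the recorded [w].  The vanishing columns express causality. *)
Lemma traj_linear k (hk : (k <= n)%N) :
  exists (P : 'M[R]_(dims k, dims 0%N)) (Q : 'M[R]_(dims k, n)),
    (forall i (j : 'I_n), (k <= j)%N -> Q i j = 0) /\
    forall A z (w : {ffun 'I_n -> H}),
      (forall i : 'I_n, (i < k)%N -> step_rel p gam A i (input A z i) (w i)) ->
      traj A hk z = mxact P z + mxact Q w.
Proof.
elim: k hk => [|k IHk] hk.
  exists 1%:M, 0; split=> [i j _|A z w _]; first by rewrite mxE.
  by rewrite mxact1 mxact0 addr0.
have [P [Q [Q0 PQ]]] := IHk (ltnW hk); pose i := Ordinal hk.
pose E := B i + in_coef F p i *: (C i *m D i).
exists (E *m P), (E *m Q + dual_coef F p gam i *: (C i *m delta_mx ord0 i)).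
split=> [a j kj|A z w rel].
  rewrite !mxE !big1 ?mulr0 ?addr0 // => b _.
    by rewrite !mxE [j == i]gtn_eqF ?andbF ?mulr0.
  by rewrite Q0 ?mulr0 // ltnW.
rewrite (traj_step (w := w)); last exact: rel.
rewrite (PQ A z w); last by move=> j jk; apply: rel; exact: ltnW.
by rewrite mxactDr -!mxactM mxactDl addrA.
Qed.

(** The first premise assumes the step relations below [i] only, so that
    they can be established one after the other from [pd_rel] for a given
    solution [z], [w]. *)
Lemma fix_iff (e : dims n = dims 0%N)
    (P : 'M[R]_(dims 0%N)) (Q : 'M_(dims 0%N, n))
    (U : 'M_(n, dims 0%N)) (N : 'M_n) :
  (forall A z (w : {ffun 'I_n -> H}) (i : 'I_n),
    (forall j : 'I_n, (j < i)%N -> step_rel p gam A j (input A z j) (w j)) ->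
    row_coef p gam i *: input A z i - diag_coef F p gam i *: w i =
      (mxact U z - mxact N w) i) ->
  (forall A z (w : {ffun 'I_n -> H}),
    (forall i, step_rel p gam A i (input A z i) (w i)) ->
    ffcast e (traj A (leqnn n) z) = mxact P z + mxact Q w) ->
  forall A,
    fix_set (fun z => ffcast e (traj A (leqnn n) z)) !=set0 <->
    exists z w, z = mxact P z + mxact Q w /\
      pd_rel p A w (mxact U z - mxact N w).
Proof.
move=> in_lin out_lin A; split=> [[z fix_z]|[z [w [fix_z rel]]]].
  have [w rel] := traj_ex A z; exists z, w; split.
    by rewrite -{1}fix_z; apply: out_lin.
  by move=> i; rewrite -(in_lin A z) //; exact: rel.
have steps i : step_rel p gam A i (input A z i) (w i).
  have [m] := ubnP (val i); elim: m i => // m IHm i /ltnSE-le_im.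
  rewrite /step_rel (in_lin A z w) //; first exact: rel.
  by move=> j ji; apply: IHm; apply: leq_trans le_im.
by exists z; rewrite /fix_set /= (out_lin A z w).
Qed.
End Trajectories.

(** * From frugal splitting operators to encodings *)

Section Lifting.
Context {R : realType} {H : completeNormedModType R} (ip : {dot H for idfun}).
Context {n : nat} (F : {set 'I_n}) (p : 'I_n).
Hypothesis pF : p \notin F.

Definition triangular_shape (N : 'M[R]_n) : Prop :=
  [/\ is_trig_mx N, forall i, 0 <= N i i & forall i, N i i = 0 <-> i \in F].

(** Row [i] of the run is [v_i = row_coef *: (a z + l w) - diag_coef *: w_i],
    where [l] vanishes from column [i] on; hence [N] is lower triangular with the
    coefficients [diag_coef] on its diagonal. *)
Lemma frugal_encodes d : lifting_numbers ip F d ->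
  exists (P : 'M[R]_d) (Q : 'M_(d, n)) (U : 'M_(n, d)) (N : 'M_n),
    triangular_shape N /\ encodes ip F p P Q U N.
Proof.
move=> [T [dims [e0 [en [tau [_ fixT defT tau_step]]]]]].
case: d / e0 T en fixT defT => T en fixT defT.
pose B i := projT1 (cid (tau_step i)).
have hB i : exists C D (g : R), 0 < g /\ forall A : op_tuple ip F,
  affine_step F i (A i) (B i) C D g (tau i A) := projT2 (cid (tau_step i)).
pose C i := projT1 (cid (hB i)).
have hC i : exists D (g : R), 0 < g /\ forall A : op_tuple ip F,
  affine_step F i (A i) (B i) (C i) D g (tau i A) := projT2 (cid (hB i)).
pose D i := projT1 (cid (hC i)).
have hD i : exists g : R, 0 < g /\ forall A : op_tuple ip F,
  affine_step F i (A i) (B i) (C i) (D i) g (tau i A) := projT2 (cid (hC i)).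
have [gam hgam] := choice hD.
have gam_gt0 i : 0 < gam i by case: (hgam i).
have steps i (A : op_tuple ip F) :
    affine_step F i (A i) (B i) (C i) (D i) (gam i) (tau i A).
  by case: (hgam i).
have lin (i : 'I_n) : exists uq : 'rV[R]_(dims 0%N) * 'rV[R]_n,
    (forall j : 'I_n, (i <= j)%N -> uq.2 ord0 j = 0) /\
    forall A z (w : {ffun 'I_n -> H}),
      (forall j : 'I_n, (j < i)%N ->
         step_rel p gam A j (input tau D A z j) (w j)) ->
      input tau D A z i = mxact uq.1 z ord0 + mxact uq.2 w ord0.
  have [P [Q [Q0 PQ]]] := traj_linear pF gam_gt0 steps (ltnW (ltn_ord i)).
  exists (D i *m P, D i *m Q); split=> [j ij|A z w rel].
    by rewrite mxE big1 // => a _; rewrite Q0 ?mulr0.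
  by rewrite /input (PQ A z w rel) mxactDr !mxactM !ffunE.
have [uq huq] := choice lin.
have [P [Q [_ PQ]]] := traj_linear pF gam_gt0 steps (leqnn n).
pose c := row_coef p gam; pose dg := diag_coef F p gam.
pose U := \matrix_i (c i *: (uq i).1).
pose N := \matrix_(i, j) ((i == j)%:R * dg i - c i * (uq i).2 ord0 j).
exists (castmx (en, erefl) P), (castmx (en, erefl) Q), U, N; split.
  have Nii i : N i i = dg i by rewrite mxE eqxx mul1r (huq i).1 // mulr0 subr0.
  split=> [|i|i]; rewrite ?Nii.
  - apply/is_trig_mxP => i j ij; rewrite mxE (huq i).1 ?(ltnW ij) //.
    by rewrite mulr0 subr0 [i == j]ltn_eqF // mul0r.
  - by rewrite /dg /diag_coef; do 2?case: ifP => // _; rewrite ?invr_ge0 ltW.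
  - rewrite /dg /diag_coef; case: (i \in F) => //; split=> // /eqP.
    by case: ifP => _; rewrite ?invr_eq0 gt_eqF.
move=> A; rewrite -(fixT A).
suff <- : fix_set (fun z => ffcast en (traj tau A (leqnn n) z)) !=set0 <->
    exists z w, z = mxact (castmx (en, erefl) P) z
        + mxact (castmx (en, erefl) Q) w /\ pd_rel p A w (mxact U z - mxact N w).
  by split=> -[z hz]; exists z; move: hz; rewrite /fix_set /= defT ffcast_id.
apply: (fix_iff pF gam_gt0 steps) => {A} [A z w i rel|A z w rel].
- rewrite ((huq i).2 A z w rel) ffun_subE !mxactE -/c -/dg.
  have sumN : \sum_j N i j *: w j =
      dg i *: w i - c i *: \sum_j (uq i).2 ord0 j *: w j.
    have -> : dg i *: w i = \sum_j ((i == j)%:R * dg i) *: w j.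
      rewrite (bigD1 i) //= eqxx mul1r big1 ?addr0 // => j /negbTE ji.
      by rewrite eq_sym ji mul0r scale0r.
    rewrite scaler_sumr -sumrB; apply: eq_bigr => j _.
    by rewrite mxE scalerBl scalerA.
  rewrite sumN opprB scalerDr addrA.
  congr (_ + _ - _); rewrite scaler_sumr; apply: eq_bigr => j _.
  by rewrite !mxE scalerA.
- rewrite (PQ A z w); last by move=> i _; apply: rel.
  have ffcastD (f g : {ffun 'I_(dims n) -> H}) :
      ffcast en (f + g) = ffcast en f + ffcast en g.
    by apply/ffunP => i; rewrite !ffunE.
  by rewrite ffcastD !ffcast_mxact.
Qed.
End Lifting.

(** * From encodings to frugal splitting operators *)

(** The state before step [k] is [(z, w_0, ..., w_(k-1), 0, ..., 0)], a vector of
    [d + n] components, except at both ends of the run, where it must have [d]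
    components: [embed] pads [z] with zeros before the first step, and the last
    [readout] returns [P z + Q w].  At the other indices both are identity
    matrices, up to the identification of [state_dims k] with [d + n]; writing
    them with [pid_mx] avoids casts. *)
Section Realisation.
Context {R : realType} {H : completeNormedModType R} (ip : {dot H for idfun}).
Hypothesis hip : norm_from_inner ip.
Context {n : nat} (F : {set 'I_n}) (p : 'I_n).
Hypothesis pF : p \notin F.
Variables (d : nat) (P : 'M[R]_d) (Q : 'M[R]_(d, n)).
Variables (U : 'M[R]_(n, d)) (N : 'M[R]_n).
Hypothesis d_gt0 : (0 < d)%N.
Hypothesis shapeN : triangular_shape F N.

Definition state_dims k : nat :=
  if (k == 0%N) || (k == n) then d else (d + n)%N.

Definition embed k : 'M[R]_(d + n, state_dims k) := pid_mx (d + n).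
Definition readout k : 'M[R]_(state_dims k, d + n) :=
  pid_mx (d + n) *m (if k == n then block_mx P Q 0 0 else 1%:M).

(** Chosen so that [diag_coef] is the diagonal of [N]. *)
Definition step_size i : R :=
  if i \in F then 1 else if i == p then (N i i)^-1 else N i i.

Lemma step_size_gt0 i : 0 < step_size i.
Proof.
have [_ N_ge0 N_eq0] := shapeN; rewrite /step_size.
case: ifPn => // iF; have Nii : 0 < N i i.
  by rewrite lt_def N_ge0 andbT; apply: contra iF => /eqP /N_eq0.
by case: ifP => _; rewrite ?invr_gt0.
Qed.

Lemma diag_coefE i : diag_coef F p step_size i = N i i.
Proof.
have [_ _ N_eq0] := shapeN; rewrite /diag_coef /step_size.
case: (boolP (i \in F)) => [iF|_]; first by rewrite (N_eq0 i).2.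
by case: (i == p); rewrite ?invrK.
Qed.

Definition slot (i : 'I_n) : 'cV[R]_(d + n) := col_mx 0 (delta_mx i ord0).
Definition strict_row (i : 'I_n) : 'rV[R]_n :=
  \row_j (if (j < i)%N then N i j else 0).
(** The argument of step [i] as a linear form of the state, scaled so that
    [row_coef *: y - diag_coef *: w_i] is component [i] of [U z - N w]. *)
Definition reading (i : 'I_n) : 'rV[R]_(d + n) :=
  (row_coef p step_size i)^-1 *: row_mx (row i U) (- strict_row i).

Let del := dual_coef F p step_size.
Let eps : 'I_n -> R := in_coef F p.

(** The step adds [w_i = (s - in_coef *: y) / dual_coef] to slot [i] of the state;
    [stepB] and [stepC] collect the contributions of the state and of [s]. *)
Definition stepB (i : 'I_n) : 'M[R]_(state_dims i.+1, state_dims i) :=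
  readout i.+1 *m (1%:M - (eps i / del i) *: (slot i *m reading i)) *m embed i.
Definition stepC (i : 'I_n) : 'cV[R]_(state_dims i.+1) :=
  readout i.+1 *m ((del i)^-1 *: slot i).
Definition stepD (i : 'I_n) : 'rV[R]_(state_dims i) := reading i *m embed i.

Definition step_map (i : 'I_n) (A : op_tuple ip F)
    (z : {ffun 'I_(state_dims i) -> H}) : {ffun 'I_(state_dims i.+1) -> H} :=
  mxact (stepB i) z +
  mxact (stepC i) [ffun=> xget 0 (eval step_size A i (mxact (stepD i) z ord0))].

Lemma step_map_affine i (A : op_tuple ip F) :
  affine_step F i (A i) (stepB i) (stepC i) (stepD i) (step_size i)
    (@step_map i A).
Proof.
move=> z; rewrite /step_map -/(eval step_size A i).
have [s ->] : exists s, eval step_size A i (mxact (stepD i) z ord0) = [set s].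
  rewrite /eval; case: ifP => iF; first exact: ops_single_valued.
  apply: (resolvent_singleton _ hip); first exact: ops_maximally_monotone.
  exact: step_size_gt0.
have -> : xget 0 [set s] = s by exact: (xgetI 0 (P := [set s]) (erefl s)).
by rewrite image_set1.
Qed.

Definition memory k : 'M[R]_n := \matrix_(i, j) ((i == j) && (j < k)%N)%:R.

Lemma memoryS k (hk : (k < n)%N) :
  memory k.+1 = memory k + delta_mx (Ordinal hk) (Ordinal hk).
Proof.
apply/matrixP => i j; rewrite !mxE -!(inj_eq val_inj) /=.
have [->|ij] := eqVneq (i : nat) j; last first.
  rewrite /= add0r; case: eqVneq => // ik; case: eqVneq => // jk.
  by rewrite ik jk eqxx in ij.
by rewrite ltnS leq_eqVlt andbb; case: ltngtP; rewrite /= ?addr0 ?add0r.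
Qed.

(** In terms of [w_i] rather than [s], a step only moves the state. *)
Lemma stepBC i :
  stepB i + eps i *: (stepC i *m stepD i) = readout i.+1 *m embed i.
Proof.
rewrite /stepB /stepC /stepD; move: (readout _) (reading i) => G r.
rewrite -!mulmxA (scalemxAr (eps i)) -mulmxDr; congr (_ *m _).
rewrite -!scalemxAl scalerA -/(eps i / del i) mulmxA.
by rewrite mulmxBl mul1mx -scalemxAl subrK.
Qed.

Lemma stepC_slot i (e : 'rV[R]_n) :
  del i *: (stepC i *m e) = readout i.+1 *m (slot i *m e).
Proof.
have del0 : del i != 0 := dual_coef_neq0 F p step_size_gt0 i.
rewrite /stepC; move: (readout _) => G.
by rewrite -!mulmxA -scalemxAl -scalemxAr scalerA mulfV // scale1r.
Qed.

Lemma embed_readout k : (0 < k < n)%N -> embed k *m readout k = 1%:M.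
Proof.
move=> /andP[k0 kn]; rewrite /embed /readout mulmxA.
have [k0' kn'] : (k == 0%N) = false /\ (k == n) = false by lia.
rewrite kn' mulmx1 mul_pid_mx /state_dims k0' kn' /= !minnn; exact: pid_mx_1.
Qed.

Let inp := input step_map stepD.

Definition full_state k z (w : {ffun 'I_n -> H}) : {ffun 'I_(d + n) -> H} :=
  mxact (col_mx 1%:M 0) z + mxact (col_mx 0 (memory k)) w.

Lemma traj_readout A z (w : {ffun 'I_n -> H}) k (hk : (k < n)%N) :
  mxact (embed k) (traj step_map A (ltnW hk) z) = full_state k z w ->
  step_rel p step_size A (Ordinal hk) (inp A z (Ordinal hk)) (w (Ordinal hk)) ->
  traj step_map A hk z = mxact (readout k.+1) (full_state k.+1 z w).
Proof.
move=> emb relk; pose i := Ordinal hk.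
rewrite (traj_step pF step_size_gt0 step_map_affine relk) -/eps -/del stepBC.
have -> : del i *: (stepC i *m delta_mx ord0 i) =
    readout k.+1 *m (slot i *m delta_mx ord0 i) := stepC_slot i _.
rewrite (mxactM (readout _) (embed _)) (mxactM (readout k.+1)) emb.
rewrite -(mxactDr (readout k.+1)) /full_state memoryS; congr (mxact _ _).
have <- : col_mx 0 (memory k) + slot i *m delta_mx ord0 i =
    col_mx 0 (memory k + delta_mx i i) :> 'M_(d + n, n).
  by rewrite /slot mul_col_mx mul0mx mul_delta_mx add_col_mx addr0.
by rewrite mxactDl addrA.
Qed.

Lemma traj_full A (z : {ffun 'I_(state_dims 0%N) -> H})
    (w : {ffun 'I_n -> H}) k (hk : (k < n)%N) :
  (forall i : 'I_n, (i < k)%N -> step_rel p step_size A i (inp A z i) (w i)) ->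
  mxact (embed k) (traj step_map A (ltnW hk) z) = full_state k z w.
Proof.
elim: k hk => [|k IHk] hk rel.
  rewrite /full_state; have -> : memory 0 = 0.
    by apply/matrixP => i j; rewrite !mxE andbF.
  rewrite col_mx0 mxact0 addr0; congr (mxact _ _).
  apply/matrixP => i j; rewrite /embed mxE.
  case: (split_ordP i) => i' ->; rewrite ?col_mxEu ?col_mxEd !mxE.
    by rewrite ltn_ord andbT.
  by rewrite eqn_leq [(_ <= j)%N]leqNgt /= ltn_addr ?(ltn_ord j).
have hk' : (k < n)%N by apply: ltnW.
rewrite (bool_irrelevance (ltnW hk) hk') (traj_readout (w := w)).
- by rewrite -mxactM embed_readout ?mxact1.
- by apply: IHk => i ik; apply: rel; apply: ltnW.
- exact: rel.
Qed.

Lemma traj_prefix A (z : {ffun 'I_(state_dims 0%N) -> H})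
    (w : {ffun 'I_n -> H}) k (hk : (k <= n)%N) :
  (0 < k)%N ->
  (forall i : 'I_n, (i < k)%N -> step_rel p step_size A i (inp A z i) (w i)) ->
  traj step_map A hk z = mxact (readout k) (full_state k z w).
Proof.
case: k hk => // k hk _ rel; apply: traj_readout; last exact: rel.
by apply: traj_full => i ik; apply: rel; apply: ltnW.
Qed.

Lemma reading_full i z w :
  row_coef p step_size i *: mxact (reading i) (full_state i z w) ord0 =
  mxact (row i U) z ord0 - mxact (strict_row i) w ord0.
Proof.
have c0 : row_coef p step_size i != 0.
  rewrite /row_coef; case: ifP => _; last exact: oner_neq0.
  by rewrite invr_eq0 gt_eqF ?step_size_gt0.
have strictM : strict_row i *m memory i = strict_row i.
  apply/rowP => j; rewrite !mxE (bigD1 j) //= !mxE eqxx /= big1 ?addr0.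
    by case: ifP => _; rewrite ?mulr1 ?mul0r.
  by move=> a /negbTE aj; rewrite !mxE aj mulr0.
rewrite /full_state mxactDr -!mxactM /reading -!scalemxAl !mul_row_col.
rewrite !mulmx1 !mulmx0 add0r addr0 mulNmx strictM.
rewrite ffun_addE !mxactZl -scalerDr scalerKV // mxactNl.
by rewrite [(- mxact _ _) _]ffunE.
Qed.

Lemma ffcast_readout (e : state_dims n = d) z w :
  ffcast e (mxact (readout n) (full_state n z w)) = mxact P z + mxact Q w.
Proof.
have memn : memory n = 1%:M.
  by apply/matrixP => i j; rewrite !mxE ltn_ord andbT.
have pidE m (em : m = d) (X : {ffun 'I_(d + n) -> H}) :
    ffcast em (mxact (pid_mx (d + n)) X) = mxact (row_mx 1%:M 0) X.
  case: d / em X => X; rewrite ffcast_id; congr (mxact _ _); apply/matrixP => i j.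
  rewrite !mxE ltn_addr ?ltn_ord // andbT; case: splitP => k ->; rewrite !mxE //.
  by rewrite eqn_leq [(_ + _ <= _)%N]leqNgt ltn_addr ?andbF.
rewrite /readout eqxx mxactM pidE -mxactM mul_row_block !mul1mx !mul0mx !addr0.
rewrite /full_state memn mxactDr -!mxactM !mul_row_col.
by rewrite !mulmx1 !mulmx0 add0r addr0.
Qed.

Lemma encodes_frugal : encodes ip F p P Q U N -> lifting_numbers ip F d.
Proof.
move=> enc.
have e : state_dims n = d by rewrite /state_dims eqxx orbT.
exists (fun A z => ffcast e (traj step_map A (leqnn n) z)).
exists state_dims, (erefl : state_dims 0%N = d), e, (fun i => @step_map i).
split.
- by move=> k _; rewrite /state_dims; case: ifP => _ //; rewrite addn_gt0 d_gt0.
- move=> A; rewrite -(enc A).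
  apply: (fix_iff pF step_size_gt0 step_map_affine (e := e))
    => {A} [A z w i rel|A z w rel].
    rewrite diag_coefE /input /stepD.
    rewrite mxactM (traj_full (w := w)) // reading_full ffun_subE !mxactE.
    rewrite -addrA; congr (_ + _); first by apply: eq_bigr => j _; rewrite mxE.
    have -> : N i i *: w i = \sum_j (if j == i then N i i else 0) *: w j.
      rewrite (bigD1 i) //= eqxx big1 ?addr0 // => j /negbTE ->.
      by rewrite scale0r.
    rewrite -opprD -big_split /=; congr (- _); apply: eq_bigr => j _.
    have [/is_trig_mxP N_trig _ _] := shapeN.
    rewrite -scalerDl mxE -(inj_eq val_inj); congr (_ *: _).
    case: ltngtP => [ji|ij|/val_inj ->]; rewrite ?addr0 ?add0r //.
    by rewrite N_trig.
  rewrite (traj_prefix (w := w)) ?(leq_ltn_trans _ (ltn_ord p)) //.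
  by rewrite ffcast_readout.
- by move=> A z; rewrite ffcast_id.
- move=> i; exists (stepB i), (stepC i), (stepD i), (step_size i); split.
    exact: step_size_gt0.
  by move=> A; apply: step_map_affine.
Qed.

End Realisation.

(** * Minimal lifting and minimal kernel rank *)

Theorem theorem6p6 (R : realType) (H : completeNormedModType R)
    (ip : {dot H for idfun}) (hip : norm_from_inner ip) (hdim : dim_ge2 H)
    (n : nat) (F : {set 'I_n}) (p : 'I_n) (hp : p \notin F) :
  exists m : nat,
    is_smallest (lifting_numbers ip F) m /\
    is_smallest (kernel_ranks R F p) m.
Proof.
have shape_kernel (N : 'M[R]_n) :
    triangular_shape F N <-> p_kernel F p (N - Gamma R p).
  have NE i : (N - Gamma R p) i i = N i i by rewrite !mxE subrr subr0.
  split=> [[tN N_ge0 N_eq0]|[_ tN N_ge0 N_eq0]].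
    by split=> [//||i|i]; rewrite ?subrK ?NE.
  by split=> [|i|i]; rewrite -?NE // -[N](subrK (Gamma R p)).
have kernel_lifting k : kernel_ranks R F p k -> lifting_numbers ip F k.
  move=> [M M_kernel <-]; have M_shape : triangular_shape F (M + Gamma R p).
    by apply/shape_kernel; rewrite addrK.
  apply: (encodes_frugal hip hp _ M_shape (@kernel_encodes _ _ _ _ _ _ M)).
  (* A kernel is nonzero, its diagonal entry at [p] being positive. *)
  rewrite lt0n mxrank_eq0; apply/eqP => M0.
  by case/negP: hp; case: M_kernel => _ _ _ <-; rewrite M0 mxE.
have lifting_kernel d : lifting_numbers ip F d ->
    exists2 k, kernel_ranks R F p k & (k <= d)%N.
  move=> /(frugal_encodes hp)[P [Q [U [N [shapeN enc]]]]].
  exists (\rank (N - Gamma R p)%R); last exact: encodes_rank hdim enc.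
  by exists (N - Gamma R p) => //; apply/shape_kernel.
have [k0 k0_rank] : exists k, kernel_ranks R F p k.
  pose N : 'M[R]_n := \matrix_(i, j) ((i == j) && (i \notin F))%:R.
  eexists; exists (N - Gamma R p); last reflexivity.
  apply/shape_kernel; split=> [|i|i]; last 2 first.
  - by rewrite mxE ler0n.
  - rewrite mxE eqxx /=; case: (i \in F) => /=; split=> // /eqP.
    by rewrite oner_eq0.
  by apply/is_trig_mxP => i j ij; rewrite mxE [i == j]ltn_eqF.
have ex_rank : exists k, `[< kernel_ranks R F p k >] by exists k0; apply/asboolP.
case: (ex_minnP ex_rank) => m /asboolP m_rank m_min.
exists m; split; split=> //; first exact: kernel_lifting.
  move=> d /lifting_kernel[k k_rank]; apply: leq_trans.
  by apply: m_min; apply/asboolP.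
by move=> k k_rank; apply: m_min; apply/asboolP.
Qed.
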